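(* Let $p\in(0,1)$, $\lambda>0$, $c\in\mathbb R$, and for $k\ge1$ let $n_k=\lfloor pk-c\sqrt k\rfloor$, $F_k=\{\omega\in\{0,1\}^k:|\omega|=n_k\}$ and $N_k=\bigl\lfloor \lambda/(p^{n_k}(1-p)^{k-n_k})\bigr\rfloor$. For $x\in\{0,1\}^{\mathbb N}$ let $\ddot M_k^x(\omega)=\#\{1\le j\le N_k:(x_j,\dots,x_{j+k-1})=\omega\}$, where $\omega$ is chosen uniformly at random from $F_k$. Then, for $\mathrm{Ber}(p)^{\mathbb N}$-almost every $x\in\{0,1\}^{\mathbb N}$, $\ddot M_k^x$ converges in distribution, as $k\to\infty$, to a Poisson random variable with parameter $\lambda$.
   Context: $\mathbb N=\{1,2,3,\dots\}$. $|\omega|=\sum_{j=1}^k\omega_j$ is the Hamming weight of $\omega\in\{0,1\}^k$. $\mathrm{Ber}(p)=p\delta_1+(1-p)\delta_0$, and $\mathrm{Ber}(p)^{\mathbb N}$ is the product measure on $\{0,1\}^{\mathbb N}$. For all sufficiently large $k$ one has $0\le n_k\le k$, so $F_k\neq\emptyset$; only such $k$ are considered. *)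

(* Defs.v *)
From HB Require Import structures.
From mathcomp Require Import all_boot all_order all_algebra.
From mathcomp Require Import all_classical all_reals all_analysis.

Set Implicit Arguments.
Unset Strict Implicit.
Unset Printing Implicit Defensive.

Import Order.TTheory GRing.Theory Num.Theory.
Import numFieldNormedType.Exports.

Local Open Scope classical_set_scope.
Local Open Scope ring_scope.

(* Infinite binary sequences.  The coordinates are numbered from 0, so that
   x_1, x_2, ... of the mathematical text are x 0, x 1, ... here.  The
   sigma-algebra is the product one, generated by the coordinate maps. *)
Definition coordinate_events : set (set (nat -> bool)) :=
  [set A | exists (j : nat) (B : set bool), A = (fun x => x j) @^-1` B].

Definition bitseq_space := g_sigma_algebraType coordinate_events.

(* mu = Ber(p)^N, through the defining property of the product measure: a
   probability measure on the product sigma-algebra is determined by its values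
   on the finite-dimensional boxes. *)
Definition is_bernoulli_product (R : realType) (p : R)
    (mu : probability bitseq_space R) : Prop :=
  forall (n : nat) (A : 'I_n -> set bool),
    mu [set x | forall i : 'I_n, A i (x i)] =
    \big[*%E/1%E]_(i < n) bernoulli_prob p (A i).

(* Convergence in distribution of real random variables, each of which may live
   on its own probability space. *)
Definition cvg_in_distribution (R : realType)
    (dk : nat -> measure_display) (Tk : forall k, measurableType (dk k))
    (Pk : forall k, probability (Tk k) R) (X : forall k, {RV (Pk k) >-> R})
    (d : measure_display) (T : measurableType d) (P : probability T R)
    (Z : {RV P >-> R}) : Prop :=
  forall r : R, {for r, continuous (cdf Z)} ->
    cdf (X k) r @[k --> \oo] --> cdf Z r.

(* The last argument of poisson_prob is unused in its definition. *)
Definition poisson_law (R : realType) (lambda : R) : probability nat R :=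
  poisson_prob lambda 0%N.

Definition natr_fun (R : realType) (n : nat) : R := n%:R.

Lemma measurable_natr_fun (R : realType) : measurable_fun setT (@natr_fun R).
Proof. by []. Qed.

HB.instance Definition _ (R : realType) :=
  isMeasurableFun.Build _ _ _ _ (@natr_fun R) (@measurable_natr_fun R).

Definition poisson_rv (R : realType) (lambda : R) :
  {RV (poisson_law lambda) >-> R} := @natr_fun R.

Lemma measurable_words (k : nat) (A : set (k.-tuple bool)) : measurable A.
Proof.
have m1 w : measurable [set w : k.-tuple bool].
  have -> : [set w] = \bigcap_(i in [set: 'I_k])
      ((fun v : k.-tuple bool => tnth v i) @^-1` [set tnth w i]).
    apply/seteqP; split => [v -> i _ //|v vw]; apply: eq_from_tnth => i.
    exact: (vw i I).
  apply: fin_bigcap_measurable => // i _.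
  by rewrite -[X in measurable X]setTI; apply: measurable_tnth.
have -> : A = \bigcup_(w in A) [set w] by rewrite bigcup_imset1 image_id.
by apply: fin_bigcup_measurable => //; exact: finite_finset.
Qed.

(* Uniform distribution on F; for F empty it is the point mass at the word
   point, a default value. *)
Definition uniform_on (R : realType) (k : nat) (F : set (k.-tuple bool)) :
    probability (k.-tuple bool) R :=
  mnormalize (mrestr (@counting _ R) (measurable_words F)) (dirac point).

Section statement_objects.
Context (R : realType).
Implicit Types (p lambda c : R) (k : nat).

Definition hamming_weight k (w : k.-tuple bool) : nat :=
  (\sum_(i < k) tnth w i)%N.

Definition weight_level p c k : int :=
  Num.floor (p * k%:R - c * Num.sqrt k%:R).

Definition level_words p c k : set (k.-tuple bool) :=
  [set w | (hamming_weight w)%:Z = weight_level p c k].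

(* The exponents are integers since weight_level may be negative or exceed k
   for small k.  The argument of truncn is positive for 0 < p < 1, 0 < lambda,
   so truncn is the floor. *)
Definition window_count p lambda c k : nat :=
  let n := weight_level p c k in
  Num.truncn (lambda / (p ^ n * (1 - p) ^ (k%:Z - n))).

Definition word_at (x : nat -> bool) k (j : nat) : k.-tuple bool :=
  [tuple x (j + i)%N | i < k].

Definition occurrences p lambda c (x : nat -> bool) k (w : k.-tuple bool) : R :=
  #|[set j : 'I_(window_count p lambda c k) | word_at x k j == w]%SET|%:R.

Lemma measurable_occurrences p lambda c (x : nat -> bool) k :
  measurable_fun setT (@occurrences p lambda c x k).
Proof. by move=> _ B _; exact: measurable_words. Qed.

HB.instance Definition _ p lambda c x k :=
  isMeasurableFun.Build _ _ _ _ (@occurrences p lambda c x k)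
    (@measurable_occurrences p lambda c x k).

Definition occurrences_rv p lambda c (x : nat -> bool) k :
  {RV (uniform_on R (level_words p c (k := k))) >-> R} :=
  @occurrences p lambda c x k.

End statement_objects.

(* Main.v *)
Require Import Defs.
From mathcomp Require Import all_boot all_order all_algebra.
From mathcomp Require Import finmap.
From mathcomp Require Import all_classical all_reals all_analysis.
From mathcomp Require Import measurable_realfun.
From mathcomp Require Import ring lra zify.

Set Implicit Arguments.
Unset Strict Implicit.
Unset Printing Implicit Defensive.

Import Order.TTheory GRing.Theory Num.Theory.
Import numFieldNormedType.Exports.

Local Open Scope classical_set_scope.
Local Open Scope ring_scope.

(* Write F for the words of weight n_k, q for their common probability, N for
   the number of windows (so that N q tends to lambda), and cut the sequence
   into B independent blocks of length L = k^3.  Let M(w) be the number of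
   windows equal to w and M'(w) the number of those lying inside a block.

   - M and M' seldom differ: averaged over w in F, the expectation of M - M' is
     O(L q + k / L), which is summable in k.
   - For 0 <= z <= 1 the average over w in F of z^M'(w) has variance O(L / |F|):
     for two independent words w, w' of F the averaged probability that w is
     seen at j and w' at j' is at most q / |F|, overlapping windows included.
   - Its expectation is the average of (E z^X(w))^B with X(w) the count in one
     block.  A word seen twice determines itself from the letters before its
     second occurrence, so clumps cost only O(L / |F|) and the expectation tends
     to exp(-(1 - z) lambda).

   As |F| grows exponentially and q <= 1 / |F|, all errors are summable in k, and
   for almost every x the generating functions converge at z = 1, 1/2, 1/3, ... *)

(** * The Bernoulli expectation of a function of a word *)

Section bernoulli_expectation.
Context (R : realFieldType) (p : R).
Implicit Types (f g : seq bool -> R) (n m : nat) (s w : seq bool).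

Definition letter_pr (b : bool) : R := if b then p else 1 - p.

(** Expectation of [f] over [n] independent Bernoulli letters. The recursion runs on lists so that
    words of different lengths can be concatenated without any measure theory. *)
Fixpoint bexp n f : R :=
  if n is n'.+1 then
    p * bexp n' (fun s => f (true :: s)) +
    (1 - p) * bexp n' (fun s => f (false :: s))
  else f [::].

Definition word_pr w : R := \prod_(b <- w) letter_pr b.

Lemma eq_bexp n f g : (forall s, size s = n -> f s = g s) ->
  bexp n f = bexp n g.
Proof.
elim: n f g => [|n IH] f g fg /=; first exact: fg.
by congr (_ * _ + _ * _); apply: IH => s sn; apply: fg; rewrite /= sn.
Qed.

Lemma bexpD n f g : bexp n (fun s => f s + g s) = bexp n f + bexp n g.
Proof. by elim: n f g => [//|n IH] f g /=; rewrite !IH; ring. Qed.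

Lemma bexpZ n c f : bexp n (fun s => c * f s) = c * bexp n f.
Proof. by elim: n f => [//|n IH] f /=; rewrite !IH; ring. Qed.

Lemma bexpN n f : bexp n (fun s => - f s) = - bexp n f.
Proof. by elim: n f => [//|n IH] f /=; rewrite !IH; ring. Qed.

Lemma bexpB n f g : bexp n (fun s => f s - g s) = bexp n f - bexp n g.
Proof. by rewrite bexpD bexpN. Qed.

Lemma bexp_cst n c : bexp n (fun=> c) = c.
Proof. by elim: n => [//|n IH] /=; rewrite !IH; ring. Qed.

Lemma bexp_sum n (I : Type) (r : seq I) (P : pred I) (f : I -> seq bool -> R) :
  bexp n (fun s => \sum_(i <- r | P i) f i s) = \sum_(i <- r | P i) bexp n (f i).
Proof.
elim: n f => [//|n IH] f /=.
by rewrite !IH !mulr_sumr -big_split.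
Qed.

(** Independence of the first [n] letters from the next [m]; the overlap and block arguments
    condition on the past through this identity. *)
Lemma bexp_cat n m f :
  bexp (n + m) f = bexp n (fun s => bexp m (fun t => f (s ++ t))).
Proof. by elim: n f => [//|n IH] f /=; rewrite !IH. Qed.

Lemma bexp_take n m f : bexp (n + m) (fun s => f (take n s)) = bexp n f.
Proof.
rewrite bexp_cat; apply: eq_bexp => s sn.
by rewrite -[RHS](bexp_cst m); apply: eq_bexp => t _; rewrite take_size_cat.
Qed.

Lemma bexp_eq w : bexp (size w) (fun s => (s == w)%:R) = word_pr w.
Proof.
rewrite /word_pr; elim: w => [|b w IH] /=; first by rewrite big_nil.
rewrite big_cons -IH.
have E c : bexp (size w) (fun s => (c :: s == b :: w)%:R) =
    (c == b)%:R * bexp (size w) (fun s => (s == w)%:R).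
  by rewrite -bexpZ; apply: eq_bexp => s _; rewrite eqseq_cons -natrM mulnb.
by rewrite !E; case: b {E} => /=; rewrite !(mul1r, mul0r, mulr0, addr0, add0r).
Qed.

Lemma bexp_prefix n w : (size w <= n)%N ->
  bexp n (fun s => (prefix w s)%:R) = word_pr w.
Proof.
move=> wn; rewrite -(subnKC wn) -bexp_eq.
rewrite -(bexp_take _ (n - size w) (fun s => (s == w)%:R)).
by apply: eq_bexp => s _; rewrite prefixE.
Qed.

Lemma bexp_prefix_drop n j w : (j + size w <= n)%N ->
  bexp n (fun s => (prefix w (drop j s))%:R) = word_pr w.
Proof.
move=> jwn; have jn : (j <= n)%N by lia.
rewrite -(subnKC jn) bexp_cat -[RHS](bexp_cst j); apply: eq_bexp => s sj.
rewrite -(@bexp_prefix (n - j)); last by lia.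
by apply: eq_bexp => t _; rewrite drop_size_cat.
Qed.

Hypotheses (p0 : 0 <= p) (p1 : p <= 1).

Lemma le_bexp n f g : (forall s, size s = n -> f s <= g s) ->
  bexp n f <= bexp n g.
Proof.
have q0 : 0 <= 1 - p by rewrite subr_ge0.
elim: n f g => [|n IH] f g fg /=; first exact: fg.
by apply: lerD; apply: ler_wpM2l => //; apply: IH => s sn; apply: fg; rewrite /= sn.
Qed.

Lemma bexp_ge0 n f : (forall s, size s = n -> 0 <= f s) -> 0 <= bexp n f.
Proof. by move=> f0; rewrite -(bexp_cst n 0); exact: le_bexp. Qed.

End bernoulli_expectation.

(** * Occurrences of a word and periodic words *)

Definition occ (w : seq bool) (n : nat) (s : seq bool) : nat :=
  \sum_(j < n) prefix w (drop j s).

Lemma occS w n s : occ w n.+1 s = (occ w n s + prefix w (drop n s))%N.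
Proof. by rewrite /occ big_ord_recr. Qed.

Lemma occD w n m s : occ w (n + m) s = (occ w n s + occ w m (drop n s))%N.
Proof.
rewrite /occ big_split_ord /=; congr (_ + _)%N.
by apply: eq_bigr => i _; rewrite drop_drop addnC.
Qed.

Lemma leq_occ w n m s : (n <= m)%N -> (occ w n s <= occ w m s)%N.
Proof. by move=> /subnKC <-; rewrite occD leq_addr. Qed.

Lemma prefix_take (w : seq bool) n s :
  (size w <= n)%N -> prefix w (take n s) = prefix w s.
Proof. by move=> wn; rewrite !prefixE take_takel. Qed.

(** Here [n] counts starting positions: the last window starts at [n - 1] and ends at
    [n - 1 + size w], which must not exceed [L]. *)
Lemma occ_take w n L s : (n + size w <= L.+1)%N ->
  occ w n (take L s) = occ w n s.
Proof.
move=> nwL; apply: eq_bigr => i _.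
have iwL : (i + size w <= L)%N by have := ltn_ord i; lia.
by rewrite -(subnK (leq_trans (leq_addr _ _) iwL)) -take_drop prefix_take //; lia.
Qed.

(* [prefix w (u ++ w)] says that w has period [size u]. *)
Lemma periodic_unique (u w w' : seq bool) : (0 < size u)%N -> size w = size w' ->
  prefix w (u ++ w) -> prefix w' (u ++ w') -> w = w'.
Proof.
move=> u0 ww' /prefixP[r ur] /prefixP[r' ur'].
apply: (@eq_from_nth _ false) => // i iw.
have [n] := ubnP i; elim: n i iw => // n IH i iw; rewrite ltnS => ni.
have E (v z : seq bool) : u ++ v = v ++ z -> (i < size v)%N ->
    nth false v i = nth false (u ++ v) i.
  by move=> -> iv; rewrite nth_cat iv.
(* By periodicity, letter [i] is letter [i] of [u], or else letter [i - size u] of the word, where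
   the induction hypothesis applies. *)
rewrite (E _ _ ur iw) (E _ _ ur') -?ww' // !nth_cat; case: ltnP => // ui.
by apply: IH; lia.
Qed.

(** * Occurrences inside one block *)

Lemma sum_at_most_one_le1 (R : realFieldType) (T : finType) (A : {set T})
    (P : pred T) : {in A &, forall x y, P x -> P y -> x = y} ->
  \sum_(x in A) (P x)%:R <= 1 :> R.
Proof.
move=> P1; case: (pickP [pred x in A | P x]) => [x /andP[xA Px]|P0].
  rewrite (bigD1 x) //= Px big1 ?addr0 // => y /andP[yA yx].
  by case: (boolP (P y)) => // Py; rewrite (P1 y x) ?eqxx in yx.
by rewrite big1 // => x xA; have /= := P0 x; rewrite xA => /= ->.
Qed.

(** Bernoulli's inequality, written for [z = 1 - t]. *)
Lemma exprn_ge1B (R : realFieldType) (z : R) n : 0 <= z -> z <= 1 ->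
  1 - (1 - z) * n%:R <= z ^+ n.
Proof.
move=> z0 z1; elim: n => [|n IH]; first by rewrite mulr0 subr0.
have := mulr_ge0 (sqr_ge0 (1 - z)) (ler0n R n).
by have := ler_wpM2l z0 IH; rewrite (exprS z) -natr1; lra.
Qed.

(** Bonferroni-type converse of [exprn_ge1B]; the double sum counts pairs of occurrences. After [X]
    occurrences a new one lowers [z ^+ X] by [(1 - z) * z ^+ X], which is at least
    [(1 - z) * (1 - (1 - z) * X)]; the defect [(1 - z) ^+ 2 * X] is at most [X], the number of new
    pairs. *)
Lemma exprn_occ_le (R : realFieldType) (z : R) (w : seq bool) n s :
  0 <= z -> z <= 1 ->
  z ^+ occ w n s <= 1 - (1 - z) * (occ w n s)%:R +
    \sum_(j' < n) \sum_(j < j') (prefix w (drop j s) && prefix w (drop j' s))%:R.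
Proof.
move=> z0 z1; elim: n => [|n IH].
  by rewrite /occ !big_ord0 expr0 mulr0 subr0 addr0.
rewrite occS big_ord_recr /=.
set S := \sum_(i < n) _ in IH *.
have -> : \sum_(j < n) (prefix w (drop j s) && prefix w (drop n s))%:R =
    (occ w n s)%:R * (prefix w (drop n s))%:R :> R.
  rewrite /occ natr_sum mulr_suml; apply: eq_bigr => j _.
  by rewrite -natrM mulnb.
case: (prefix w (drop n s)); rewrite ?addn1 ?addn0 ?mulr0 ?addr0 //.
have : z ^+ occ w n s <= 1 by rewrite exprn_ile1.
have := @exprn_ge1B _ z (occ w n s) z0 z1.
have t0 : 0 <= 1 - z by rewrite subr_ge0.
move=> /(ler_wpM2l t0) + _.
have := IH; rewrite (exprS z) -natr1 !mulr1; set X := (occ w n s)%:R.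
have zX : 0 <= z * X by rewrite mulr_ge0 // ler0n.
by have := mulr_ge0 t0 zX; lra.
Qed.

Section one_block.
Context (R : realFieldType) (p : R) (k : nat) (F : {set k.-tuple bool}) (pi : R).
Hypotheses (p0 : 0 <= p) (p1 : p <= 1).
Hypothesis F_pi : forall w, w \in F -> word_pr p w = pi.
Implicit Types (s : seq bool) (w : k.-tuple bool).

Local Notation E := (bexp p).

Lemma prefix_tuple_inj s w w' : prefix w s -> prefix w' s -> w = w'.
Proof.
by rewrite !prefixE !size_tuple => /eqP + /eqP e; rewrite e => /val_inj.
Qed.

Lemma sum_prefix_le1 s : \sum_(w in F) (prefix w s)%:R <= 1 :> R.
Proof.
by apply: sum_at_most_one_le1 => w w' _ _; exact: prefix_tuple_inj.
Qed.

(** The words of [F] are disjoint events of probability [pi]. The resulting bound [pi <= 1 / #|F|]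
    is what makes [pi] small later on. *)
Lemma card_mul_pr_le1 : #|F|%:R * pi <= 1.
Proof.
have -> : #|F|%:R * pi = E k (fun s => \sum_(w in F) (prefix w s)%:R).
  rewrite bexp_sum (eq_bigr (fun=> pi)); last first.
    by move=> w wF; rewrite bexp_prefix ?size_tuple // F_pi.
  by rewrite sumr_const mulr_natl.
by rewrite -[leRHS](bexp_cst p k); apply: le_bexp => // s _; exact: sum_prefix_le1.
Qed.

(* Given the letters before j', the word seen at j' determines the one seen at
   j; it can only be the same word w for one value of w. *)
Lemma sum_self_overlap L j j' : 0 <= pi -> (j < j')%N -> (j' + k <= L)%N ->
  \sum_(w in F) E L (fun s => (prefix w (drop j s) && prefix w (drop j' s))%:R)
    <= pi.
Proof.
move=> pi0 jj' j'kL; have j'L : (j' <= L)%N by lia.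
(* Once [w] is seen at [j'], whether it is also seen at [j] depends only on the letters [u] before
   [j']: this is [rep w u], independent of the letters from [j'] on. *)
pose rep w u := (prefix w (drop j u ++ w))%:R : R.
have -> : \sum_(w in F)
    E L (fun s => (prefix w (drop j s) && prefix w (drop j' s))%:R) =
    \sum_(w in F) pi * E j' (rep w).
  apply: eq_bigr => w wF; rewrite -(subnKC j'L) bexp_cat -bexpZ.
  apply: eq_bexp => u uj'; rewrite -(F_pi wF).
  rewrite -(bexp_prefix p (n := L - j')) ?size_tuple; last by lia.
  rewrite [RHS]mulrC -bexpZ; apply: eq_bexp => v _.
  rewrite (_ : drop j' (u ++ v) = v); last by rewrite drop_size_cat.
  rewrite (_ : drop j (u ++ v) = drop j u ++ v); last by rewrite drop_cat uj' jj'.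
  rewrite /rep -natrM mulnb; congr (_%:R); congr nat_of_bool.
  case: (boolP (prefix w v)) => [/prefixP[r ->]|_]; last by rewrite !andbF.
  by rewrite !andbT catA !prefixE takel_cat // size_cat leq_addl.
rewrite -mulr_sumr -bexp_sum -[leRHS]mulr1; apply: ler_wpM2l => //.
rewrite -[leRHS](bexp_cst p j'); apply: le_bexp => // u uj'.
apply: sum_at_most_one_le1 => w w' _ _ ww ww'; apply: val_inj.
by apply: periodic_unique ww ww'; rewrite ?size_tuple // size_drop uj'; lia.
Qed.

(** At most one [w'] is seen at [j'], so on the event that [w] is seen at [j] the sum over [w'] is
    at most 1, whether or not the two windows overlap. *)
Lemma sum_cross_overlap L j j' : (j + k <= L)%N ->
  \sum_(w in F) \sum_(w' in F)
    E L (fun s => (prefix w (drop j s))%:R * (prefix w' (drop j' s))%:R)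
    <= #|F|%:R * pi.
Proof.
move=> jkL; rewrite -sum1_card natr_sum mulr_suml; apply: ler_sum => w wF.
rewrite mul1r -(F_pi wF) -bexp_sum -(bexp_prefix_drop p (n := L) (j := j)).
  apply: le_bexp => // s _; rewrite -mulr_sumr ler_piMr //.
  exact: sum_prefix_le1.
by rewrite size_tuple.
Qed.

Context (L n : nat) (z : R).
Hypotheses (nkL : (n + k <= L.+1)%N) (z0 : 0 <= z) (z1 : z <= 1) (pi0 : 0 <= pi).

Local Notation X w s := (occ w n s).

Lemma bexp_occ w : w \in F -> E L (fun s => (X w s)%:R) = n%:R * pi.
Proof.
move=> wF; rewrite (eq_bexp _ (g := fun s => \sum_(j < n) (prefix w (drop j s))%:R)).
  rewrite bexp_sum (eq_bigr (fun=> pi)) ?sumr_const ?card_ord ?mulr_natl //.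
  move=> j _; rewrite bexp_prefix_drop ?F_pi // size_tuple.
  by rewrite -ltnS; apply: leq_trans nkL; rewrite -addSn leq_add2r.
by move=> s _; rewrite natr_sum.
Qed.

(** By [exprn_ge1B] and [exprn_occ_le] the error lies between 0 and the expected number of pairs of
    occurrences. A single word may overlap itself often; only after summing over [F] does each pair
    of positions cost at most [pi]. *)
Lemma sum_block_pgf :
  \sum_(w in F) `|E L (fun s => z ^+ X w s) - (1 - (1 - z) * (n%:R * pi))|
    <= n%:R ^+ 2 * pi.
Proof.
pose S w := \sum_(j' < n) \sum_(j < j')
  E L (fun s => (prefix w (drop j s) && prefix w (drop j' s))%:R).
apply: (@le_trans _ _ (\sum_(w in F) S w)).
  apply: ler_sum => w wF; rewrite -(bexp_occ wF) -bexpZ.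
  rewrite -[Y in _ - (Y - _)](bexp_cst p L 1) -bexpB -bexpB ger0_norm.
    rewrite /S; under eq_bigr => j' _ do rewrite -bexp_sum.
    rewrite -bexp_sum; apply: le_bexp => // s _.
    by rewrite lerBlDl; exact: exprn_occ_le.
  by apply: bexp_ge0 => // s _; rewrite subr_ge0 exprn_ge1B.
rewrite /S exchange_big /=.
apply: (@le_trans _ _ (\sum_(j' < n) \sum_(j < j') pi)).
  apply: ler_sum => j' _; rewrite exchange_big /=; apply: ler_sum => j _.
  by apply: sum_self_overlap => //; have := ltn_ord j'; lia.
apply: (@le_trans _ _ (\sum_(j' < n) n%:R * pi)).
  apply: ler_sum => j' _; rewrite sumr_const card_ord -[leLHS]mulr_natl.
  by rewrite ler_wpM2r // ler_nat ltnW.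
by rewrite sumr_const card_ord -[leLHS]mulr_natl expr2 mulrA.
Qed.

(** The covariance of [f] and [g] is that of [1 - f] and [1 - g], which are nonnegative and
    dominated by [X] and [Y]. *)
Lemma norm_covariance_le (f g X Y : seq bool -> R) :
    (forall s, 0 <= 1 - f s <= X s) -> (forall s, 0 <= 1 - g s <= Y s) ->
  `|E L (fun s => f s * g s) - E L f * E L g| <=
    E L (fun s => X s * Y s) + E L X * E L Y.
Proof.
move=> fX gY.
pose f' s := 1 - f s; pose g' s := 1 - g s.
have Ef : E L f' = 1 - E L f by rewrite bexpB bexp_cst.
have Eg : E L g' = 1 - E L g by rewrite bexpB bexp_cst.
have -> : E L (fun s => f s * g s) - E L f * E L g =
    E L (fun s => f' s * g' s) - E L f' * E L g'.
  rewrite Ef Eg (eq_bexp _ (f := fun s => f' s * g' s)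
      (g := fun s => (1 - f s - g s) + f s * g s)).
    by rewrite bexpD !bexpB bexp_cst; ring.
  by move=> s _; rewrite /f' /g'; ring.
have f0 : 0 <= E L f' by apply: bexp_ge0 => // s _; case/andP: (fX s).
have g0 : 0 <= E L g' by apply: bexp_ge0 => // s _; case/andP: (gY s).
have fE : E L f' <= E L X by apply: le_bexp => // s _; case/andP: (fX s).
have gE : E L g' <= E L Y by apply: le_bexp => // s _; case/andP: (gY s).
apply: (le_trans (ler_normB _ _)); rewrite !ger0_norm ?mulr_ge0 //.
- apply: lerD; last by apply: ler_pM.
  apply: le_bexp => // s _; case/andP: (fX s) => ? ?; case/andP: (gY s) => ? ?.
  exact: ler_pM.
- by apply: bexp_ge0 => // s _; apply: mulr_ge0; case/andP: (fX s);
    case/andP: (gY s).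
Qed.

(** Since [0 <= 1 - z ^+ m <= m], the counts dominate. Their joint moments are summed by
    [sum_cross_overlap] over [n ^ 2] pairs of positions; the products of means add up to
    [(n * #|F| * pi) ^ 2], no larger because [#|F| * pi <= 1]. *)
Lemma sum_block_covariance :
  \sum_(w in F) \sum_(w' in F)
    `|E L (fun s => z ^+ X w s * z ^+ X w' s) -
      E L (fun s => z ^+ X w s) * E L (fun s => z ^+ X w' s)|
    <= 2 * (n%:R ^+ 2 * (#|F|%:R * pi)).
Proof.
have zX m : 0 <= 1 - z ^+ m <= (m%:R : R).
  rewrite subr_ge0 exprn_ile1 //= lerBlDl -lerBlDr.
  apply: le_trans (exprn_ge1B m z0 z1); rewrite lerB // ler_piMl //.
  by rewrite gerBl.
apply: (@le_trans _ _ (\sum_(w in F) \sum_(w' in F)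
    (E L (fun s => (X w s)%:R * (X w' s)%:R) + (n%:R * pi) * (n%:R * pi)))).
  apply: ler_sum => w wF; apply: ler_sum => w' w'F.
  by rewrite -{1}(bexp_occ wF) -(bexp_occ w'F); apply: norm_covariance_le => s.
under eq_bigr => w wF do rewrite big_split /=.
rewrite big_split /= [leRHS]mulr_natl mulr2n; apply: lerD.
  rewrite (eq_bigr (fun w : k.-tuple bool => \sum_(w' in F) \sum_(j < n) \sum_(j' < n)
    E L (fun s => (prefix w (drop j s))%:R * (prefix w' (drop j' s))%:R))).
    under eq_bigr => w wF do rewrite exchange_big /=.
    rewrite exchange_big /=.
    apply: (@le_trans _ _ (\sum_(j < n) \sum_(j' < n) #|F|%:R * pi)).
      apply: ler_sum => j _; under eq_bigr => w wF do rewrite exchange_big /=.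
      rewrite exchange_big /=; apply: ler_sum => j' _.
      by apply: sum_cross_overlap; have := ltn_ord j; lia.
    by rewrite !sumr_const !card_ord -mulrnA -[leLHS]mulr_natl natrM expr2.
  move=> w wF; apply: eq_bigr => w' w'F.
  under eq_bigr => j _ do rewrite -bexp_sum.
  rewrite -bexp_sum; apply: eq_bexp => s _.
  rewrite /occ !natr_sum mulr_suml; apply: eq_bigr => j _.
  by rewrite mulr_sumr.
rewrite !sumr_const -mulrnA -[leLHS]mulr_natl natrM.
have -> : #|F|%:R * #|F|%:R * (n%:R * pi * (n%:R * pi)) =
  (n%:R ^+ 2 * (#|F|%:R * pi)) * (#|F|%:R * pi) by ring.
by rewrite ler_piMr ?card_mul_pr_le1 // mulr_ge0 ?exprn_ge0 // mulr_ge0.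
Qed.

End one_block.

(** * Independent blocks *)

Definition block (L i : nat) (s : seq bool) : seq bool := take L (drop (i * L) s).

Lemma block_take L B i s : (i < B)%N -> block L i (take (B * L) s) = block L i s.
Proof.
move=> iB; have iLB : (i.+1 * L <= B * L)%N by rewrite leq_mul2r iB orbT.
by rewrite /block !take_drop take_takel // -mulSn.
Qed.

Lemma block_cat L B i (u v : seq bool) : (i < B)%N -> size u = (B * L)%N ->
  block L i (u ++ v) = block L i u.
Proof. by move=> iB uBL; rewrite -(block_take _ _ iB) take_size_cat. Qed.

(** Telescoping: the factors are replaced one at a time, and all others are at most 1. *)
Lemma distXn_le (R : realFieldType) (a b : R) n :
  0 <= a <= 1 -> 0 <= b <= 1 -> `|a ^+ n - b ^+ n| <= n%:R * `|a - b|.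
Proof.
move=> /andP[a0 a1] /andP[b0 b1]; elim: n => [|n IH].
  by rewrite !expr0 subrr normr0 mul0r.
have -> : a ^+ n.+1 - b ^+ n.+1 = a * (a ^+ n - b ^+ n) + (a - b) * b ^+ n.
  by rewrite !exprS; ring.
apply: le_trans (ler_normD _ _) _; rewrite !normrM -natr1 mulrDl mul1r.
rewrite (ger0_norm a0) (ger0_norm (exprn_ge0 n b0)); apply: lerD.
  by apply: le_trans IH; rewrite ler_piMl.
by rewrite ler_piMr // exprn_ile1.
Qed.

Section blocks.
Context (R : realFieldType) (p : R).
Hypotheses (p0 : 0 <= p) (p1 : p <= 1).
Local Notation E := (bexp p).

Lemma bexp_blocks_prod L B (f : seq bool -> R) :
  E (B * L) (fun s => \prod_(i < B) f (block L i s)) = E L f ^+ B.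
Proof.
elim: B => [|B IH]; first by rewrite mul0n /= big_ord0.
rewrite mulSnr bexp_cat exprSr -IH [RHS]mulrC -bexpZ.
apply: eq_bexp => u uBL; rewrite [RHS]mulrC -bexpZ.
apply: eq_bexp => v vL; rewrite big_ord_recr /=; congr (_ * f _).
  by apply: eq_bigr => i _; rewrite (block_cat (B := B)).
by rewrite /block drop_size_cat // take_oversize ?vL.
Qed.

Lemma bexp_blocks_sum L B (f : seq bool -> R) :
  E (B * L) (fun s => \sum_(i < B) f (block L i s)) = B%:R * E L f.
Proof.
elim: B => [|B IH]; first by rewrite mul0n /= big_ord0 mul0r.
rewrite mulSnr bexp_cat -natr1 mulrDl mul1r -IH -[Y in _ = _ + Y](bexp_cst p (B * L)).
rewrite -bexpD; apply: eq_bexp => u uBL.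
rewrite -[Y in _ = Y + _](bexp_cst p L) -bexpD.
apply: eq_bexp => v vL; rewrite big_ord_recr /=; congr (_ + f _).
  by apply: eq_bigr => i _; rewrite (block_cat (B := B)).
by rewrite /block drop_size_cat // take_oversize ?vL.
Qed.

Lemma sum_occ_block_le L B n w s : (n <= L)%N -> (n + size w <= L.+1)%N ->
  (\sum_(i < B) occ w n (block L i s) <= occ w (B * L) s)%N.
Proof.
move=> nL nwL; elim: B => [|B IH]; first by rewrite big_ord0.
rewrite big_ord_recr /= mulSnr occD leq_add // occ_take //.
exact: leq_occ.
Qed.

End blocks.

Section average.
Context (R : realFieldType) (T : finType) (F : {set T}).

(** Expectation under the uniform law on [F]; for empty [F] the value is 0, as [0^-1 = 0]. *)
Definition avg (f : T -> R) : R := (#|F|%:R)^-1 * \sum_(w in F) f w.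

Lemma avgB f g : avg (fun w => f w - g w) = avg f - avg g.
Proof. by rewrite /avg -mulrBr -sumrB. Qed.

Lemma eq_avg f g : {in F, f =1 g} -> avg f = avg g.
Proof. by move=> fg; congr (_ * _); apply: eq_bigr => w; exact: fg. Qed.

Lemma le_avg f g : (forall w, w \in F -> f w <= g w) -> avg f <= avg g.
Proof. by move=> fg; rewrite ler_wpM2l ?invr_ge0 // ler_sum. Qed.

Lemma avg_cst c : (0 < #|F|)%N -> avg (fun=> c) = c.
Proof.
move=> F0; rewrite /avg sumr_const -[Y in _ * Y]mulr_natl mulKf //.
by rewrite pnatr_eq0 -lt0n.
Qed.

Lemma avg_ge0 f : (forall w, w \in F -> 0 <= f w) -> 0 <= avg f.
Proof. by move=> f0; rewrite mulr_ge0 ?invr_ge0 ?sumr_ge0. Qed.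

Lemma norm_avg_le f : `|avg f| <= avg (fun w => `|f w|).
Proof.
by rewrite /avg normrM ger0_norm ?invr_ge0 // ler_wpM2l ?invr_ge0 ?ler_norm_sum.
Qed.

End average.

(** * Lost windows, variance and mean over many blocks *)

Section many_blocks.
Context (R : realFieldType) (p : R) (k : nat) (F : {set k.-tuple bool}) (pi : R).
Hypotheses (p0 : 0 <= p) (p1 : p <= 1) (pi0 : 0 <= pi) (F0 : (0 < #|F|)%N).
Hypothesis F_pi : forall w, w \in F -> word_pr p w = pi.
Context (N B L n : nat) (z : R).
Hypotheses (nkL : (n + k <= L.+1)%N) (z0 : 0 <= z) (z1 : z <= 1).
Hypotheses (BLN : (B * L <= N)%N) (nL : (n <= L)%N).
Implicit Types (s : seq bool) (w : k.-tuple bool).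

Local Notation E := (bexp p).

(** The count [M']: windows that straddle two blocks or reach beyond the last block are left out. *)
Definition block_occ w s : nat := \sum_(i < B) occ w n (block L i s).

Lemma block_occ_le w s : (block_occ w s <= occ w N s)%N.
Proof.
apply: leq_trans (leq_occ _ _ BLN); apply: sum_occ_block_le => //.
by rewrite size_tuple.
Qed.

(** By linearity: each window equals [w] with probability [pi], and [B * n] of the [N] windows lie
    inside blocks. *)
Lemma bexp_lost_occ :
  E (N + k) (fun s => avg F (fun w => (occ w N s)%:R - (block_occ w s)%:R)) =
  (N%:R - B%:R * n%:R) * pi.
Proof.
rewrite /avg bexpZ bexp_sum -[RHS](avg_cst _ F0); congr (_ * _).
apply: eq_bigr => w wF; rewrite bexpB mulrBl; congr (_ - _).
  exact: (bexp_occ F_pi (leqnSn _) wF).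
have BLNk : (B * L <= N + k)%N by exact: leq_trans BLN (leq_addr _ _).
rewrite -(subnKC BLNk) -mulrA -(bexp_occ F_pi nkL wF) -bexp_blocks_sum.
rewrite -(bexp_take p (B * L) (N + k - B * L)); apply: eq_bexp => s _.
by rewrite /block_occ natr_sum; apply: eq_bigr => i _; rewrite block_take.
Qed.

Definition block_pgf w : R := E L (fun s => z ^+ occ w n s) ^+ B.

Lemma unit_pgf w : 0 <= E L (fun s => z ^+ occ w n s) <= 1.
Proof.
rewrite bexp_ge0 //= => [|s _]; last exact: exprn_ge0.
by rewrite -[leRHS](bexp_cst p L); apply: le_bexp => // s _; rewrite exprn_ile1.
Qed.

Lemma bexp_pgf_prod w w' :
  E (N + k) (fun s => z ^+ block_occ w s * z ^+ block_occ w' s) =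
  E L (fun s => z ^+ occ w n s * z ^+ occ w' n s) ^+ B.
Proof.
have BLNk : (B * L <= N + k)%N by exact: leq_trans BLN (leq_addr _ _).
rewrite -(subnKC BLNk) -bexp_blocks_prod -(bexp_take p (B * L) (N + k - B * L)).
apply: eq_bexp => s _; rewrite /block_occ !expr_sum -big_split /=.
by apply: eq_bigr => i _; rewrite block_take.
Qed.

Lemma bexp_pgf w : E (N + k) (fun s => z ^+ block_occ w s) = block_pgf w.
Proof.
have BLNk : (B * L <= N + k)%N by exact: leq_trans BLN (leq_addr _ _).
rewrite -(subnKC BLNk) /block_pgf -bexp_blocks_prod.
rewrite -(bexp_take p (B * L) (N + k - B * L)).
apply: eq_bexp => s _; rewrite /block_occ expr_sum.
by apply: eq_bigr => i _; rewrite block_take.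
Qed.

(** The variance of an average is the average of the covariances over pairs of words. By
    independence of the blocks, a covariance has the form [a ^+ B - b ^+ B], with [a - b] the
    covariance in one block; [distXn_le] reduces it to [sum_block_covariance]. *)
Lemma bexp_pgf_variance :
  E (N + k) (fun s => (avg F (fun w => z ^+ block_occ w s) - avg F block_pgf) ^+ 2)
  <= 2 * (B%:R * n%:R ^+ 2 * pi / #|F|%:R).
Proof.
pose A w s := z ^+ block_occ w s - block_pgf w.
have -> : E (N + k) (fun s =>
      (avg F (fun w => z ^+ block_occ w s) - avg F block_pgf) ^+ 2) =
    (#|F|%:R)^-1 ^+ 2 * \sum_(w in F) \sum_(w' in F)
      E (N + k) (fun s => A w s * A w' s).
  under eq_bigr => w wF do rewrite -bexp_sum.
  rewrite -bexp_sum -bexpZ; apply: eq_bexp => s _.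
  rewrite -avgB /avg exprMn; congr (_ * _).
  by rewrite expr2 mulr_suml; apply: eq_bigr => w wF; rewrite mulr_sumr.
apply: (@le_trans _ _ ((#|F|%:R)^-1 ^+ 2 *
    (B%:R * (2 * (n%:R ^+ 2 * (#|F|%:R * pi)))))).
  rewrite ler_wpM2l ?exprn_ge0 ?invr_ge0 //.
  apply: le_trans (ler_wpM2l _ (sum_block_covariance p0 p1 F_pi nkL z0 z1 pi0)) => //.
  rewrite mulr_sumr; apply: ler_sum => w wF.
  rewrite mulr_sumr; apply: ler_sum => w' w'F.
  have -> : E (N + k) (fun s => A w s * A w' s) =
     E L (fun s => z ^+ occ w n s * z ^+ occ w' n s) ^+ B -
     (E L (fun s => z ^+ occ w n s) * E L (fun s => z ^+ occ w' n s)) ^+ B.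
    rewrite -bexp_pgf_prod exprMn -!/(block_pgf _).
    rewrite (eq_bexp _ (g := fun s => (z ^+ block_occ w s * z ^+ block_occ w' s -
        block_pgf w' * z ^+ block_occ w s - block_pgf w * z ^+ block_occ w' s) +
        block_pgf w * block_pgf w')).
      by rewrite bexpD !bexpB !bexpZ bexp_cst !bexp_pgf; ring.
    by move=> s _; rewrite /A; ring.
  apply: le_trans (ler_norm _) _; apply: distXn_le.
    rewrite bexp_ge0 //= => [|s _]; last by rewrite mulr_ge0 ?exprn_ge0.
    rewrite -[leRHS](bexp_cst p L); apply: le_bexp => // s _.
    by rewrite mulr_ile1 ?exprn_ge0 ?exprn_ile1.
  have /andP[? ?] := unit_pgf w; have /andP[? ?] := unit_pgf w'.
  by rewrite mulr_ge0 ?mulr_ile1.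
have F0' : #|F|%:R != 0 :> R by rewrite pnatr_eq0 -lt0n.
by rewrite le_eqVlt; apply/orP; left; apply/eqP; field.
Qed.

(** [distXn_le] passes from one block, treated in [sum_block_pgf], to [B] blocks; the bound on
    [n * pi] keeps both bases in the unit interval. *)
Lemma avg_block_pgf_le : n%:R * pi <= 1 ->
  `|avg F block_pgf - (1 - (1 - z) * (n%:R * pi)) ^+ B| <=
  B%:R * n%:R ^+ 2 * pi / #|F|%:R.
Proof.
move=> npi1; rewrite -[Y in _ - Y](avg_cst _ F0) -avgB.
apply: le_trans (norm_avg_le _ _) _.
have npi0 : 0 <= n%:R * pi by rewrite mulr_ge0.
apply: (@le_trans _ _ ((#|F|%:R)^-1 * (B%:R * \sum_(w in F)
   `|E L (fun s => z ^+ occ w n s) - (1 - (1 - z) * (n%:R * pi))|))).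
  rewrite ler_wpM2l ?invr_ge0 // mulr_sumr; apply: ler_sum => w wF.
  apply: distXn_le; first exact: unit_pgf.
  have t0 : 0 <= 1 - z by rewrite subr_ge0.
  by rewrite subr_ge0 mulr_ile1 ?gerBl ?mulr_ge0.
rewrite mulrC ler_wpM2r ?invr_ge0 // -mulrA ler_wpM2l //.
exact: (sum_block_pgf p0 p1 F_pi nkL z0 z1 pi0).
Qed.

End many_blocks.

(** * From the product measure to words, and almost sure convergence *)

(** A telescoping sum, serving as explicit majorant for sums of inverse squares. *)
Lemma sum_inverse_pronic (R : realFieldType) n :
  \sum_(k < n) (k.+1 * k.+2)%:R^-1 = 1 - n.+1%:R^-1 :> R.
Proof.
elim: n => [|n IH]; first by rewrite big_ord0 invr1 subrr.
have n1 : n%:R + 1 != 0 :> R by rewrite natr1 pnatr_eq0.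
have n2 : n%:R + 1 + 1 != 0 :> R by rewrite !natr1 pnatr_eq0.
by rewrite big_ord_recr /= IH natrM -!natr1; field; rewrite n1 n2.
Qed.

Section summable_integrals.
Context d (T : measurableType d) (R : realType) (mu : {measure set T -> \bar R}).
Implicit Types (Y : nat -> T -> R).

(** The sum of all [Y k] has integral at most [M], so it is finite almost everywhere, and the terms
    of a convergent series tend to 0. *)
Lemma ae_cvg0_summable Y (u : nat -> R) (M : R) :
  (forall k, measurable_fun setT (Y k)) -> (forall k x, 0 <= Y k x) ->
  (forall k, (\int[mu]_x (Y k x)%:E <= (u k)%:E)%E) ->
  (forall n, \sum_(k < n) u k <= M) ->
  {ae mu, forall x, Y k x @[k --> \oo] --> 0}.
Proof.
move=> mY Y0 Yu uM; pose S x := (\sum_(k <oo) (Y k x)%:E)%E.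
have Y0e k x : (0 <= (Y k x)%:E)%E by rewrite lee_fin.
have mYe k : measurable_fun setT (fun x => (Y k x)%:E).
  by apply/measurable_EFinP.
have S0 x : (0 <= S x)%E by apply: nneseries_ge0.
have iS : mu.-integrable setT S.
  apply/integrableP; split; first exact: ge0_emeasurable_sum.
  under eq_integral => x _ do rewrite gee0_abs //.
  rewrite integral_nneseries //; apply: (@le_lt_trans _ _ M%:E); last exact: ltry.
  apply: lime_le.
    by apply: is_cvg_nneseries => n _ _; apply: integral_ge0.
  apply: nearW => n; rewrite big_mkord.
  apply: (@le_trans _ _ (\sum_(k < n) (u k)%:E)%E); first exact: lee_sum.
  by rewrite sumEFin lee_fin.
have := integrable_ae measurableT iS; apply: filterS => x /(_ I) Sfin.
apply: cvg_series_cvg_0; apply: nondecreasing_is_cvgn.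
  by apply: nondecreasing_series => k _ _.
exists (fine (S x)) => _ [n _ <-].
rewrite -lee_fin fineK // /series /= -sumEFin.
by apply: nneseries_lim_ge => k _ _.
Qed.

Lemma ae_cvg0_inverse_square Y (C : R) :
  (forall k, measurable_fun setT (Y k)) -> (forall k x, 0 <= Y k x) ->
  (\forall k \near \oo, (\int[mu]_x (Y k x)%:E <= (C / k%:R ^+ 2)%:E)%E) ->
  {ae mu, forall x, Y k x @[k --> \oo] --> 0}.
Proof.
move=> mY Y0 [K _ YC].
(* The shift passes the rank [K] from which the bound holds, and gives
   [(k + 1) * (k + 2) <= (k + K + 2) ^ 2]. *)
suff : {ae mu, forall x, Y (k + K.+2)%N x @[k --> \oo] --> 0}.
  by apply: filterS => x; rewrite (cvg_shiftn _ (Y ^~ x)).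
apply: (@ae_cvg0_summable (fun k => Y (k + K.+2)%N)
  (fun k => `|C| * (k.+1 * k.+2)%:R^-1) `|C|) => //.
  move=> k; apply: le_trans (YC (k + K.+2)%N _) _; first by rewrite /=; lia.
  rewrite lee_fin; apply: (@le_trans _ _ (`|C| / (k + K.+2)%:R ^+ 2)).
    by rewrite ler_wpM2r ?invr_ge0 ?exprn_ge0 // ler_norm.
  rewrite ler_wpM2l // -natrX lef_pV2 ?posrE ?ltr0n ?ler_nat ?muln_gt0 ?expn_gt0 //.
    by nia.
  by lia.
move=> n; by rewrite -mulr_sumr sum_inverse_pronic ler_piMr // gerBl.
Qed.


End summable_integrals.

Lemma sum_tuple_eq (R : realFieldType) n (f : seq bool -> R) s : size s = n ->
  f s = \sum_(t : n.-tuple bool) f t * (s == t)%:R.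
Proof.
move=> sn; have ss : size s == n by apply/eqP.
rewrite (bigD1 (Tuple ss)) //= eqxx mulr1 big1 ?addr0 // => t ts.
case: eqP => [st|]; last by rewrite mulr0.
by case/eqP: ts; apply: val_inj.
Qed.

Lemma bexp_tupleE (R : realFieldType) (p : R) n (f : seq bool -> R) :
  bexp p n f = \sum_(t : n.-tuple bool) f t * word_pr p t.
Proof.
rewrite (eq_bexp _ (g := fun s => \sum_(t : n.-tuple bool) f t * (s == t)%:R)).
  rewrite bexp_sum; apply: eq_bigr => t _; rewrite bexpZ -[in RHS](bexp_eq p t).
  by rewrite size_tuple.
by move=> s; exact: sum_tuple_eq.
Qed.

Section bernoulli_product.
Context (R : realType) (p : R) (mu : probability bitseq_space R).
Hypotheses (p0 : 0 <= p) (p1 : p <= 1) (mup : is_bernoulli_product p mu).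

(** Written as a box of singletons, so that [is_bernoulli_product] applies directly. *)
Definition cylinder n (t : n.-tuple bool) : set bitseq_space :=
  [set x | forall i : 'I_n, [set tnth t i] (x i)].

Lemma measurable_cylinder n (t : n.-tuple bool) : measurable (cylinder t).
Proof.
have -> : cylinder t = \bigcap_(i in [set: 'I_n])
    ((fun x : bitseq_space => x i) @^-1` [set tnth t i]).
  by apply/seteqP; split => [x xt i _|x xt i]; [exact: xt|exact: xt i I].
apply: fin_bigcap_measurable => // i _; apply: sub_sigma_algebra.
by exists i, [set tnth t i].
Qed.

Lemma mem_cylinder n (t : n.-tuple bool) (x : bitseq_space) :
  (x \in cylinder t) = (mkseq x n == t).
Proof.
apply/idP/eqP => [/set_mem xt|xt].
  apply: (@eq_from_nth _ false); rewrite ?size_mkseq ?size_tuple // => i ni.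
  by rewrite nth_mkseq // (xt (Ordinal ni)) (tnth_nth false).
apply/mem_set => i /=; rewrite (tnth_nth false) -xt nth_mkseq //.
Qed.

Lemma measure_cylinder n (t : n.-tuple bool) : mu (cylinder t) = (word_pr p t)%:E.
Proof.
apply: etrans (mup (fun i => [set tnth t i])) _.
rewrite /word_pr big_tuple -prodEFin; apply: eq_bigr => i _.
by rewrite /bernoulli_prob p0 p1 /= fsbig_set1.
Qed.

Lemma mkseq_sum_indic n (f : seq bool -> R) (x : bitseq_space) :
  f (mkseq x n) = \sum_(t : n.-tuple bool) f t * \1_(cylinder t) x.
Proof.
rewrite (@sum_tuple_eq _ n) ?size_mkseq //; apply: eq_bigr => t _.
by rewrite indicE mem_cylinder.
Qed.

Lemma measurable_mkseq n (f : seq bool -> R) :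
  measurable_fun setT (fun x : bitseq_space => f (mkseq x n)).
Proof.
rewrite (_ : (fun x => _) = fun x => \sum_(t : n.-tuple bool) f t * \1_(cylinder t) x).
  apply: measurable_sum => t; apply: measurable_funM => //.
  by apply: measurable_indic; exact: measurable_cylinder.
by apply/funext => x; exact: mkseq_sum_indic.
Qed.

(** The bridge from the product measure to [bexp]: a function of the first [n] coordinates is a
    finite combination of indicators of cylinders. *)
Lemma integral_mkseq n (f : seq bool -> R) : (forall s, 0 <= f s) ->
  (\int[mu]_x (f (mkseq x n))%:E = (bexp p n f)%:E)%E.
Proof.
move=> f0; under eq_integral => x _ do rewrite mkseq_sum_indic -sumEFin.
rewrite ge0_integral_sum //=.
- rewrite bexp_tupleE -sumEFin; apply: eq_bigr => t _.
  under eq_integral => x _ do rewrite EFinM.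
  rewrite ge0_integralZl //=.
  + rewrite integral_indic //; last exact: measurable_cylinder.
    by rewrite setIT EFinM -measure_cylinder.
  + by apply/measurable_EFinP/measurable_indic; exact: measurable_cylinder.
  + by rewrite lee_fin.
- move=> t; apply/measurable_EFinP/measurable_funM => //.
  by apply: measurable_indic; exact: measurable_cylinder.
- by move=> t x _; rewrite lee_fin mulr_ge0.
Qed.

End bernoulli_product.

(** * Generating functions *)

(** Encodes [G z] as the sum of the series of [a i * z ^+ i] by bounds on its remainders, valid when
    the [a i] are nonnegative with total mass at most 1; the zero mass function of an empty [F] is
    thus included. *)
Definition is_pgf (R : realType) (a : nat -> R) (G : R -> R) :=
  forall z m, 0 <= z -> z <= 1 -> 0 <= G z - \sum_(i < m) a i * z ^+ i <= z ^+ m.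

(** Induction on [m]: with the first [m] terms subtracted, what remains is the [m]-th coefficient
    times [z ^+ m], up to [z ^+ m.+1]. After division by [z ^+ m] the error is at most [z], and the
    points [1 / (j + 1)] are arbitrarily small. *)
Lemma pgf_cvg_pmf (R : realType) (a : nat -> nat -> R) (G : nat -> R -> R) b H :
  (forall k, is_pgf (a k) (G k)) -> is_pgf b H ->
  (forall j, G k j.+1%:R^-1 @[k --> \oo] --> H j.+1%:R^-1) ->
  forall m, a k m @[k --> \oo] --> b m.
Proof.
move=> aG bH GH m; have [n] := ubnP m; elim: n m => // n IH m; rewrite ltnS => mn.
apply/cvgrPdist_lt => e e0.
have [j je] : exists j, j.+1%:R^-1 < e / 2.
  exists (Num.truncn (e / 2)^-1); rewrite invf_plt ?posrE ?divr_gt0 //.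
  exact: truncnS_gt.
set z := j.+1%:R^-1 in je; have z0 : 0 < z by rewrite invr_gt0.
have z1 : z <= 1 by rewrite invf_le1 // ler1n.
have zm0 : 0 < z ^+ m by rewrite exprn_gt0.
have : G k z - \sum_(i < m) a k i * z ^+ i @[k --> \oo] -->
       H z - \sum_(i < m) b i * z ^+ i.
  apply: cvgB; first exact: GH.
  apply: cvg_big => [|i _]; first exact: add_continuous.
  by apply: cvgMr_tmp; apply: IH; exact: leq_trans (ltn_ord i) mn.
move/cvgrPdist_lt/(_ (z ^+ m * (e / 2))); rewrite !mulr_gt0 ?divr_gt0 //.
move=> /(_ isT); apply: filterS => k.
have /andP[] := aG k z m.+1 (ltW z0) z1; have /andP[] := bH z m.+1 (ltW z0) z1.
rewrite !big_ord_recr /= exprSr.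
move=> U0 U1 T0 T1.
rewrite !ltr_norml => /andP[TU UT].
have : z ^+ m * z < z ^+ m * (e / 2) by rewrite ltr_pM2l.
rewrite -(ltr_pM2l zm0 (- e)) -(ltr_pM2l zm0 _ e); move: (z ^+ m * z) U0 U1 T0 T1 => y.
by move=> *; apply/andP; split; lra.
Qed.

Lemma avg_is_pgf (R : realType) (T : finType) (F : {set T}) (M : T -> nat) :
  is_pgf (fun m => avg F (fun w => (M w == m)%:R : R))
    (fun z => avg F (fun w => z ^+ M w)).
Proof.
move=> z m z0 z1.
have -> : \sum_(i < m) avg F (fun w => (M w == i)%:R) * z ^+ i =
    avg F (fun w => \sum_(i < m) (M w == i)%:R * z ^+ i).
  rewrite /avg exchange_big /= mulr_sumr; apply: eq_bigr => i _.
  by rewrite -mulrA mulr_suml.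
rewrite -avgB.
have D w : 0 <= z ^+ M w - \sum_(i < m) (M w == i)%:R * z ^+ i <= z ^+ m.
  case: (ltnP (M w) m) => Mm.
    rewrite (bigD1 (Ordinal Mm)) //= eqxx mul1r big1 ?addr0 ?subrr ?lexx ?exprn_ge0 //.
    by move=> i; rewrite -val_eqE /= eq_sym => /negbTE ->; rewrite mul0r.
  rewrite big1 ?subr0 ?exprn_ge0 ?ler_wiXn2l //= => i _.
  by rewrite gtn_eqF ?mul0r // (leq_trans (ltn_ord i)).
apply/andP; split; first by apply: avg_ge0 => w _; case/andP: (D w).
apply: le_trans (le_avg (g := fun=> z ^+ m) _) _ => [w _|].
  by case/andP: (D w).
case: (posnP #|F|) => [F0|/avg_cst-> //].
by rewrite /avg F0 invr0 mul0r exprn_ge0.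
Qed.

Section poisson_pgf.
Context (R : realType).
Implicit Types x y z lambda : R.

Lemma series_exp_coeff_le x n : 0 <= x -> series (exp_coeff x) n <= expR x.
Proof.
move=> x0; apply: nondecreasing_cvgn_le; last exact: is_cvg_series_exp_coeff.
by apply: nondecreasing_series => k _ _; exact: exp_coeff_ge0.
Qed.

(** The tail of the exponential series at [lambda * z] from rank [m] on is at most [z ^+ m] times
    the one at [lambda], hence at most [z ^+ m * expR lambda]. *)
Lemma poisson_is_pgf lambda : 0 < lambda ->
  is_pgf (poisson_pmf lambda) (fun z => expR (- ((1 - z) * lambda))).
Proof.
move=> l0 z m z0 z1.
have -> : expR (- ((1 - z) * lambda)) = expR (- lambda) * expR (lambda * z).
  by rewrite -expRD; congr expR; ring.
have -> : \sum_(i < m) poisson_pmf lambda i * z ^+ i =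
    expR (- lambda) * series (exp_coeff (lambda * z)) m.
  rewrite /series /= big_mkord mulr_sumr; apply: eq_bigr => i _.
  by rewrite /poisson_pmf l0 /exp_coeff /= exprMn; ring.
have lz0 : 0 <= lambda * z by rewrite mulr_ge0 // ltW.
rewrite -mulrBr; apply/andP; split.
  by rewrite mulr_ge0 ?expR_ge0 // subr_ge0 series_exp_coeff_le.
rewrite expRN mulrC ler_pdivrMr ?expR_gt0 // lerBlDl.
apply: limr_le; first exact: is_cvg_series_exp_coeff.
exists m => // n /= mn.
rewrite -lerBlDl sub_series_geq //.
apply: (@le_trans _ _ (z ^+ m * series (exp_coeff lambda) n)); last first.
  by rewrite ler_wpM2l ?exprn_ge0 // series_exp_coeff_le // ltW.
rewrite -(subrK (series (exp_coeff lambda) m) (series _ n)) sub_series_geq //.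
rewrite addrC mulrDr.
rewrite -[leLHS]add0r; apply: lerD.
  rewrite mulr_ge0 ?exprn_ge0 // sumr_ge0 // => i _.
  by apply: exp_coeff_ge0; exact: ltW.
rewrite mulr_sumr ler_sum_nat // => i /andP[mi _].
rewrite /exp_coeff /= exprMn mulrAC [leRHS]mulrC ler_wpM2l ?ler_wiXn2l //.
by rewrite divr_ge0 // exprn_ge0 // ltW.
Qed.

(** From [1 + y <= expR y] one gets [expR (- y) <= (1 + y)^-1], and [(1 + y) * (1 - y + y ^+ 2) = 1
    + y ^+ 3 >= 1]. *)
Lemma expRN_dist_le y : 0 <= y -> `|1 - y - expR (- y)| <= y ^+ 2.
Proof.
move=> y0; rewrite ler0_norm; last by rewrite subr_le0 expR_ge1Dx.
rewrite opprB lerBlDr expRN.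
have y1 : 0 < 1 + y by rewrite ltr_wpDr.
apply: (@le_trans _ _ (1 + y)^-1).
  by rewrite lef_pV2 ?posrE ?expR_gt0 // expR_ge1Dx.
rewrite -[leLHS]mul1r ler_pdivrMr //.
have : 0 <= y ^+ 3 by rewrite exprn_ge0.
by lra.
Qed.

Lemma expr1B_dist_expR n y : 0 <= y -> y <= 1 ->
  `|(1 - y) ^+ n - expR (- (n%:R * y))| <= n%:R * y ^+ 2.
Proof.
move=> y0 y1; rewrite -mulrN expRM_natl.
apply: le_trans (distXn_le _ _ _) _.
- by rewrite subr_ge0 y1 gerBl.
- by rewrite expR_ge0 expR_le1 oppr_le0.
- by rewrite ler_wpM2l // expRN_dist_le.
Qed.

End poisson_pgf.

(** * Uniform words of given weight *)

Lemma counting_fintype (R : realType) (T : finType) (A : set T) :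
  counting A = (\sum_(w : T) (w \in A)%:R)%:E :> \bar R.
Proof.
rewrite /counting; case: asboolP => [_|]; last by case; exact: finite_finset.
congr EFin; rewrite -natr_sum; congr (_%:R).
rewrite -[LHS](card_uniqP (fset_uniq (fset_set A))) -sum1_card big_mkcond /=.
apply: eq_bigr => w _; rewrite in_fset_set; last exact: finite_finset.
by case: (w \in A).
Qed.

Lemma mnormalize_fin d (T : measurableType d) (R : realType)
    (mu : {measure set T -> \bar R}) (P : probability T R) (A : set T) (r : R) :
  mu setT = r%:E -> r != 0 -> mnormalize mu P A = (mu A * r^-1%:E)%E.
Proof.
by move=> muT r0; rewrite /mnormalize muT /= eqe (negbTE r0).
Qed.

Lemma uniform_on_avg (R : realType) k (F : {set k.-tuple bool})
    (A : set (k.-tuple bool)) : (0 < #|F|)%N ->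
  uniform_on R [set w | w \in F] A = (avg F (fun w => (w \in A)%:R))%:E.
Proof.
move=> F0.
have memF w : (w \in [set w | w \in F]) = (w \in F).
  by apply/idP/idP => [/set_mem|/mem_set].
have cF : counting [set w | w \in F] = #|F|%:R%:E :> \bar R.
  rewrite counting_fintype -sum1_card natr_sum [in RHS]big_mkcond; congr EFin.
  by apply: eq_bigr => w _; rewrite memF; case: (w \in F).
have F0r : #|F|%:R != 0 :> R by rewrite pnatr_eq0 -lt0n.
rewrite /uniform_on /= (mnormalize_fin _ _ _ F0r); last first.
  by rewrite /= /mrestr setTI.
rewrite /= /mrestr.
rewrite counting_fintype -EFinM /avg mulrC; congr (_ * _)%:E.
rewrite [RHS]big_mkcond; apply: eq_bigr => w _.
by rewrite in_setI memF andbC; case: (w \in F).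
Qed.

Lemma take_drop_mkseq (x : nat -> bool) N k j : (j < N)%N ->
  take k (drop j (mkseq x (N + k))) = word_at x k j.
Proof.
move=> jN; have kle : (k <= size (drop j (mkseq x (N + k))))%N.
  by rewrite size_drop size_mkseq; lia.
have sk : size (take k (drop j (mkseq x (N + k)))) = k by exact: size_takel.
apply: (@eq_from_nth _ false) => [|i]; rewrite sk ?size_tuple // => ik.
rewrite nth_take // nth_drop nth_mkseq; last by lia.
by rewrite -[i in RHS]/(nat_of_ord (Ordinal ik)) -tnth_nth tnth_mktuple.
Qed.

Lemma occurrences_occ (R : realType) (p lambda c : R) (x : nat -> bool) k
    (w : k.-tuple bool) :
  occurrences p lambda c x w = (occ w (window_count p lambda c k)
    (mkseq x (window_count p lambda c k + k)))%:R.
Proof.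
rewrite /occurrences /occ -sum1_card big_mkcond /=; congr (_%:R).
by apply: eq_bigr => j _; rewrite inE prefixE size_tuple take_drop_mkseq.
Qed.

Lemma sum_leq_pmf (R : realType) (T : finType) (F : {set T}) (M : T -> nat) m :
  avg F (fun w => (M w <= m)%:R : R) =
  \sum_(i < m.+1) avg F (fun w => (M w == i)%:R).
Proof.
rewrite /avg -mulr_sumr exchange_big /=; congr (_ * _); apply: eq_bigr => w _.
case: leqP => mM; last first.
  rewrite big1 // => i _; rewrite gtn_eqF //.
  exact: leq_trans (ltn_ord i) mM.
rewrite (bigD1 (Ordinal (mM : (M w < m.+1)%N))) //= eqxx big1 ?addr0 // => i.
by rewrite -val_eqE /= eq_sym => /negbTE ->.
Qed.

Lemma natr_le_truncn (R : realType) (r : R) n : 0 <= r ->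
  (n%:R <= r) = (n <= Num.truncn r)%N.
Proof. by move=> r0; rewrite truncn_ge_nat. Qed.

Lemma cdf_poisson (R : realType) (lambda r : R) : 0 < lambda -> 0 <= r ->
  cdf (poisson_rv lambda) r =
  (\sum_(i < (Num.truncn r).+1) poisson_pmf lambda i)%:E.
Proof.
move=> l0 r0; rewrite /cdf /distribution /pushforward /=.
rewrite /poisson_law /poisson_prob l0.
have -> : poisson_rv lambda @^-1` `]-oo, r] = `I_(Num.truncn r).+1.
  by apply/seteqP; split => n /=; rewrite in_itv /= /poisson_rv /natr_fun natr_le_truncn.
rewrite esum_fset //; last by move=> i _; rewrite lee_fin poisson_pmf_ge0.
by rewrite -fsbig_ord sumEFin.
Qed.

Lemma hamming_weight_count k (w : k.-tuple bool) : hamming_weight w = count id w.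
Proof.
rewrite /hamming_weight -sum1_count [RHS]big_mkcond big_tuple.
by apply: eq_bigr => i _; case: (tnth w i).
Qed.

Lemma word_pr_weight (R : realFieldType) (p : R) k (w : k.-tuple bool) n :
  hamming_weight w = n -> word_pr p w = p ^+ n * (1 - p) ^+ (k - n).
Proof.
move=> wn; have nE : n = count id w by rewrite -wn hamming_weight_count.
have kE : (k - n = count negb w)%N.
  have := count_predC id w; rewrite size_tuple nE => kw.
  by rewrite -[X in (X - _)%N]kw addKn.
rewrite kE nE /word_pr; elim: (val w) => [|b s IH]; first by rewrite big_nil mulr1.
by rewrite big_cons IH; case: b; rewrite /= ?add0n ?add1n ?exprS /letter_pr; ring.
Qed.

(* Witness: the words u ~u 1...1 0...0, where u has length m, have weight n. *)
Lemma card_weight_ge k n m : (m <= n)%N -> (m <= k - n)%N -> (n <= k)%N ->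
  (2 ^ m <= #|[set w : k.-tuple bool | hamming_weight w == n]%SET|)%N.
Proof.
move=> mn mkn nk.
pose g (u : m.-tuple bool) :=
  u ++ map negb u ++ nseq (n - m) true ++ nseq (k - n - m) false.
have gk u : size (g u) == k.
  by apply/eqP; rewrite /g !size_cat size_map !size_nseq size_tuple; lia.
have g_inj : injective (fun u => Tuple (gk u)).
  move=> u u' /(congr1 val) /= /eqP; rewrite /g eqseq_cat ?size_tuple //.
  by case/andP => /eqP /val_inj.
have <- : #|[set: m.-tuple bool]%SET| = (2 ^ m)%N.
  by rewrite cardsT card_tuple card_bool.
rewrite -(card_imset _ g_inj); apply: subset_leq_card; apply/fintype.subsetP => w.
case/imsetP => u _ ->; rewrite inE hamming_weight_count.
rewrite /= /g !count_cat !count_nseq count_map /= mul1n mul0n addn0.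
have := count_predC id u; rewrite size_tuple.
rewrite (eq_count (a1 := predC id) (a2 := preim negb id)) // => mE.
by rewrite addnA mE subnKC.
Qed.

(** * Asymptotics of the parameters *)

(** Fifth power of [m <= 5 * 2 ^ (m %/ 5)]. The exponent is [3 + 2]: the size of [F] must beat the
    block length [k ^ 3] and still leave a summable [1 / k ^ 2]. *)
Lemma leq_exp5_exp2 m : (m ^ 5 <= 5 ^ 5 * 2 ^ m)%N.
Proof.
have m5 : (m <= 5 * 2 ^ (m %/ 5))%N.
  have := ltn_expl (m %/ 5) (isT : (1 < 2)%N); have := ltn_pmod m (isT : (0 < 5)%N).
  by have := divn_eq m 5; lia.
have := leq_exp2r m (5 * 2 ^ (m %/ 5)) (isT : (0 < 5)%N); rewrite m5 => /idP m5'.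
apply: leq_trans m5' _; rewrite expnMn -expnM leq_mul2l /= leq_pexp2l //.
exact: leq_trunc_div.
Qed.

Section level_sets.
Context (R : realType).
Implicit Types (p lambda c d : R).

Definition level_set p c k : {set k.-tuple bool} :=
  [set w | (hamming_weight w)%:Z == weight_level p c k]%SET.

(** For large [k], the common probability of the words in [level_set]. With these integer exponents,
    [window_count] is [Num.truncn (lambda / level_pr p c k)] by conversion. *)
Definition level_pr p c k : R :=
  p ^ weight_level p c k * (1 - p) ^ (k%:Z - weight_level p c k).

Lemma sqrt_negligible c d : 0 < d ->
  \forall k \near \oo, `|c| * Num.sqrt k%:R + 1 <= d * k%:R.
Proof.
(* Threshold for [y], the square root of [k]: beyond it [d * y >= |c| + 1] and [y >= 1], so
   [d * y ^+ 2 >= |c| * y + 1]. *)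
move=> d0; pose Y := (`|c| + 1) / d + 1.
have Y1 : 1 <= Y by rewrite lerDr divr_ge0 ?ltW // addr_ge0.
near=> k; set y := Num.sqrt k%:R.
have yE : k%:R = y ^+ 2 :> R by rewrite sqr_sqrtr.
have Yy : Y <= y.
  rewrite -(@ger0_norm _ Y) ?(le_trans ler01) // -sqrtr_sqr ler_wsqrtr //.
  by near: k; exact: nbhs_infty_ger.
have cy : `|c| + 1 <= d * y.
  apply: le_trans (_ : d * Y <= _); last by rewrite ler_pM2l.
  by rewrite mulrDr mulr1 mulrCA divff ?gt_eqF // mulr1 lerDl ltW.
rewrite yE expr2 mulrA; have y1 : 1 <= y by exact: le_trans Yy.
apply: le_trans (_ : (`|c| + 1) * y <= _); last by rewrite ler_wpM2r ?sqrtr_ge0.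
by rewrite mulrDl lerD2l mul1r.
Unshelve. all: by end_near. Qed.

Lemma weight_level_linear p c : 0 < p -> p < 1 -> exists2 d : R, 0 < d &
  \forall k \near \oo, exists n : nat, [/\ weight_level p c k = n%:Z, (n <= k)%N,
    d * k%:R <= n%:R & d * k%:R <= (k - n)%:R].
Proof.
(* Both [p] and [1 - p] are at least [2 * d]; one [d * k] absorbs the square root term and the
   rounding, the other remains. *)
move=> p0 p1; pose d := Num.min p (1 - p) / 2.
have dp : 2 * d <= p by rewrite /d mulrC divfK // ge_min lexx.
have dq : 2 * d <= 1 - p by rewrite /d mulrC divfK // ge_min lexx orbT.
have d0 : 0 < d by rewrite divr_gt0 // lt_min p0 subr_gt0.
exists d => //; apply: filterS (sqrt_negligible c d0) => k ck.
set r := p * k%:R - c * Num.sqrt k%:R.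
have k0 : 0 <= k%:R :> R by [].
have y0 : 0 <= Num.sqrt k%:R :> R by exact: sqrtr_ge0.
have := ler_wpM2r y0 (ler_norm c); have := ler_wpM2r y0 (ler_norm (- c)).
rewrite normrN mulNr => c1 c2.
have dp' := ler_wpM2r k0 dp; have dq' := ler_wpM2r k0 dq.
have fl := ge_floor (r : R); have fl' := floorD1_gt (r : R).
rewrite -/(weight_level p c k) in fl fl' *.
have f0 : 0 <= weight_level p c k.
  rewrite /weight_level floor_ge0 -/r /r.
  have dk : 0 <= d * k%:R by rewrite mulr_ge0 // ltW.
  by lra.
case: (weight_level p c k) f0 fl fl' => // n _; rewrite intrD /= => fl fl'.
have nk : (n <= k)%N.
  rewrite -(ler_nat R); apply: le_trans fl _; rewrite /r.
  have dk : 0 <= d * k%:R by rewrite mulr_ge0 // ltW.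
  by lra.
exists n; split => //; first by move: fl'; rewrite /r; lra.
by rewrite natrB //; move: fl; rewrite /r; lra.
Qed.

(** With [m = minn n (k - n) >= d * k], the set has at least [2 ^ m >= m ^ 5 / 5 ^ 5] words, whence
    the constant [5 ^ 5 / d ^ 5]. *)
Lemma level_set_growth p c : 0 < p -> p < 1 -> exists2 C : R, 0 <= C &
  \forall k \near \oo, [/\ (0 < k)%N, (0 < #|level_set p c k|)%N,
    forall w : k.-tuple bool, w \in level_set p c k -> word_pr p w = level_pr p c k,
    0 < level_pr p c k & k%:R ^+ 3 / #|level_set p c k|%:R <= C / k%:R ^+ 2].
Proof.
move=> p0 p1; have [d d0 dn] := weight_level_linear c p0 p1.
exists ((5 ^ 5)%:R / d ^+ 5); first by rewrite divr_ge0 // exprn_ge0 // ltW.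
near=> k; have k0 : (0 < k)%N by near: k; exact: nbhs_infty_gt.
have [n [wn nk dkn dkn']] : exists n : nat, [/\ weight_level p c k = n%:Z, (n <= k)%N,
    d * k%:R <= n%:R & d * k%:R <= (k - n)%:R] by near: k.
have lE : level_set p c k = [set w : k.-tuple bool | hamming_weight w == n]%SET.
  by apply/setP => w; rewrite !inE wn.
have lpE : level_pr p c k = p ^+ n * (1 - p) ^+ (k - n).
  by rewrite /level_pr wn subzn // -!exprnP.
pose m := minn n (k - n).
have := @card_weight_ge k n m (geq_minl _ _) (geq_minr _ _) nk; rewrite -lE => Fm.
have F0 : (0 < #|level_set p c k|)%N by apply: leq_trans Fm; rewrite expn_gt0.
split => //.
- by move=> w; rewrite lE inE => /eqP /(word_pr_weight p) ->.
- by rewrite lpE mulr_gt0 // exprn_gt0 // subr_gt0.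
have dkm : d * k%:R <= m%:R by rewrite /m; case: leqP.
have kr0 : 0 < k%:R :> R by rewrite ltr0n.
have Fr0 : 0 < #|level_set p c k|%:R :> R by rewrite ltr0n.
have mF : m%:R ^+ 5 <= (5 ^ 5)%:R * #|level_set p c k|%:R :> R.
  rewrite -natrX -natrM ler_nat; apply: leq_trans (leq_exp5_exp2 m) _.
  by rewrite leq_mul2l Fm orbT.
rewrite ler_pdivrMr // mulrAC ler_pdivlMr ?exprn_gt0 // -exprD mulrAC.
rewrite ler_pdivlMr ?exprn_gt0 // -exprMn mulrC; apply: le_trans mF.
by rewrite lerXn2r // ?nnegrE ?mulr_ge0 // ltW.
Unshelve. all: by end_near. Qed.

End level_sets.

(* [f] is the number of words, [pi] their probability and [C] the constant of
   level_set_growth. *)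
Lemma block_parameter_bounds (R : realType) (lambda C pi f : R) (k : nat) :
  let L := (k ^ 3)%N in let N := Num.truncn (lambda / pi) in
  let B := (N %/ L)%N in let n := (L - k).+1 in
  0 < lambda -> 0 <= C -> 0 < pi -> 0 < f -> f * pi <= 1 -> (0 < k)%N ->
  k%:R ^+ 3 / f <= C / k%:R ^+ 2 ->
  [/\ (N%:R - B%:R * n%:R) * pi <= (C + lambda) / k%:R ^+ 2,
      B%:R * n%:R ^+ 2 * pi / f <= lambda * C / k%:R ^+ 2,
      n%:R * pi <= C / k%:R ^+ 2,
      B%:R * (n%:R * pi) ^+ 2 <= lambda * C / k%:R ^+ 2 &
      `|lambda - B%:R * (n%:R * pi)| <= (2 * C + lambda) / k%:R ^+ 2].
Proof.
move=> L N B n l0 C0 pi0 f0 fpi k0 kC.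
have kr0 : 0 < k%:R :> R by rewrite ltr0n.
have kL : (k <= L)%N by rewrite -[k in (k <= _)%N]expn1 leq_pexp2l.
have LE : L%:R = k%:R ^+ 3 :> R by rewrite natrX.
have L0 : 0 < L%:R :> R by rewrite LE exprn_gt0.
have pif : pi <= f^-1 by rewrite -[leRHS]mul1r ler_pdivlMr // mulrC.
have Lpi : L%:R * pi <= C / k%:R ^+ 2.
  by apply: le_trans kC; rewrite LE ler_wpM2l // exprn_ge0.
have Npi : N%:R * pi <= lambda.
  rewrite -ler_pdivlMr // truncn_le //.
  by rewrite divr_ge0 // ltW.
have Npi' : lambda < (N%:R + 1) * pi.
  by rewrite -ltr_pdivrMr // natr1 truncnS_gt.
have BLN : (B * L <= N)%N by exact: leq_trunc_div.
have NBL : (N < B * L + L)%N by rewrite -mulSnr ltn_ceil // expn_gt0 k0.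
have nL : (n <= L)%N by rewrite /n ltn_subrL k0 (leq_trans k0).
have nkL : (n + k)%N = L.+1 by rewrite /n addSn subnK.
have BLpi : B%:R * L%:R * pi <= lambda.
  by apply: le_trans Npi; rewrite ler_pM2r // -natrM ler_nat.
have nLr : n%:R <= L%:R :> R by rewrite ler_nat.
have n0 : 0 <= n%:R :> R by [].
have B0 : 0 <= B%:R :> R by [].
have BnL : B%:R * n%:R * pi <= lambda.
  by apply: le_trans BLpi; rewrite ler_wpM2r ?(ltW pi0) // ler_wpM2l.
have npi : n%:R * pi <= C / k%:R ^+ 2.
  by apply: le_trans Lpi; rewrite ler_wpM2r // ltW.
(* The choice [L = k ^ 3] enters here: [k = L / k ^ 2], so the windows straddling block ends cost at
   most [lambda / k ^ 2]. *)
have Bk : B%:R * k%:R * pi <= lambda / k%:R ^+ 2.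
  rewrite ler_pdivlMr ?exprn_gt0 //; apply: le_trans BLpi.
  by have -> : B%:R * k%:R * pi * k%:R ^+ 2 = B%:R * L%:R * pi by rewrite LE; ring.
(* Fewer than [L] windows start after the last block, and [L - n = k - 1] are lost at the end of
   each block. *)
have lost : (N%:R - B%:R * n%:R) * pi <= (C + lambda) / k%:R ^+ 2.
  rewrite [leRHS]mulrDl; apply: le_trans (lerD Lpi Bk).
  rewrite -mulrDl ler_wpM2r ?(ltW pi0) //.
  rewrite lerBlDr -!natrM -!natrD ler_nat; apply: leq_trans (ltnW NBL) _.
  by rewrite addnC -addnA leq_add2l -mulnDr (addnC k) nkL leq_mul2l leqnSn orbT.
have nf : n%:R / f <= C / k%:R ^+ 2.
  by apply: le_trans kC; rewrite -LE ler_wpM2r // invr_ge0 ltW.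
have Bnpi0 : 0 <= B%:R * n%:R * pi by rewrite !mulr_ge0 // ltW.
have k2 : 0 <= (k%:R ^+ 2)^-1 :> R by rewrite invr_ge0 exprn_ge0.
split => //.
- have -> : B%:R * n%:R ^+ 2 * pi / f = (B%:R * n%:R * pi) * (n%:R / f) by ring.
  by rewrite -[leRHS]mulrA; apply: ler_pM => //; rewrite divr_ge0 // ltW.
- have -> : B%:R * (n%:R * pi) ^+ 2 = (B%:R * n%:R * pi) * (n%:R * pi) by ring.
  by rewrite -[leRHS]mulrA; apply: ler_pM => //; rewrite mulr_ge0 // ltW.
- rewrite mulrA ger0_norm ?subr_ge0 //.
  (* Rounding down to [N] changes [lambda] by less than [pi], which is absorbed in a second
     [C / k ^ 2]. *)
  have piL : pi <= L%:R * pi by rewrite ler_peMl ?(ltW pi0) // ler1n -(ltr0n R).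
  have piC := le_trans piL Lpi; rewrite !mulrDl in lost Npi' *; lra.
Qed.

(** * Quenched convergence *)

Lemma cvg_inverse_square (R : realType) (u : nat -> R) (l D : R) :
  (\forall k \near \oo, `|l - u k| <= D / k%:R ^+ 2) -> u k @[k --> \oo] --> l.
Proof.
move=> uD; apply/cvgrPdist_lt => e e0; near=> k.
have k1 : 1 <= k%:R :> R by near: k; exact: nbhs_infty_ger.
have kD : `|D| / e < k%:R by near: k; exact: nbhs_infty_gtr.
have k0 : 0 < k%:R :> R by exact: lt_le_trans k1.
apply: (@le_lt_trans _ _ (D / k%:R ^+ 2)); first by near: k.
rewrite ltr_pdivrMr ?exprn_gt0 // mulrC; apply: le_lt_trans (ler_norm D) _.
rewrite -ltr_pdivrMr //; apply: lt_le_trans kD _.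
by rewrite expr2 ler_peMl // ltW.
Unshelve. all: by end_near. Qed.

Lemma distXn_nat_le (R : realFieldType) (z : R) (m n : nat) : 0 <= z -> z <= 1 ->
  `|z ^+ m - z ^+ n| <= `|m%:R - n%:R|.
Proof.
move=> z0 z1; wlog mn : m n / (m <= n)%N.
  by move=> H; case: (leqP m n) => [|/ltnW] /H //; rewrite distrC (distrC n%:R).
rewrite -(subnKC mn) exprD -[X in X - _]mulr1 -mulrBr.
rewrite natrD opprD addrA subrr add0r normrN normr_nat.
rewrite ger0_norm ?mulr_ge0 ?exprn_ge0 ?subr_ge0 ?exprn_ile1 //.
apply: (@le_trans _ _ (1 - z ^+ (n - m))).
  by rewrite ler_piMl ?subr_ge0 ?exprn_ile1.
have := exprn_ge1B (n - m) z0 z1.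
have : (1 - z) * (n - m)%:R <= (n - m)%:R by rewrite ler_piMl // gerBl.
by lra.
Qed.

Section quenched_pgf.
Context (R : realType) (p lambda c : R) (mu : probability bitseq_space R).
Hypotheses (p0 : 0 < p) (p1 : p < 1) (l0 : 0 < lambda).
Hypothesis mup : is_bernoulli_product p mu.
Implicit Types (z : R) (k : nat) (s : seq bool) (x : nat -> bool).

Local Notation F := (level_set p c).
Local Notation N := (window_count p lambda c).
Local Notation L k := (k ^ 3)%N.
Local Notation B k := (N k %/ L k)%N.
Local Notation n k := (L k - k).+1.

(** The average of [|M - M'|]; the absolute value makes it nonnegative for every [k], as
    [ae_cvg0_inverse_square] requires. *)
Definition lost k s : R :=
  avg (F k) (fun w => `|(occ w (N k) s)%:R - (block_occ (B k) (L k) (n k) w s)%:R|).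

Definition mean_pgf z k : R := avg (F k) (block_pgf p (B k) (L k) (n k) z).

Definition fluctuation z k s : R :=
  (avg (F k) (fun w => z ^+ block_occ (B k) (L k) (n k) w s) - mean_pgf z k) ^+ 2.

Let p0' := ltW p0.
Let p1' := ltW p1.

Lemma block_geometry k : (0 < k)%N ->
  [/\ (n k + k <= (L k).+1)%N, (n k <= L k)%N & (B k * L k <= N k)%N].
Proof.
move=> k0; have kL : (k <= L k)%N by rewrite -[k in (k <= _)%N]expn1 leq_pexp2l.
by split; [lia|lia|exact: leq_trunc_div].
Qed.

(** All estimates with one constant and the summable rate [1 / k ^ 2]; [D] does not depend on
    [z]. *)
Lemma near_block_bounds : exists2 D : R, 0 <= D & \forall k \near \oo,
  [/\ bexp p (N k + k) (lost k) <= D / k%:R ^+ 2,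
      forall z, 0 <= z -> z <= 1 ->
        bexp p (N k + k) (fluctuation z k) <= D / k%:R ^+ 2,
      `|lambda - (B k)%:R * ((n k)%:R * level_pr p c k)| <= D / k%:R ^+ 2 &
      forall z, 0 <= z -> z <= 1 -> `|mean_pgf z k -
        expR (- ((1 - z) * ((B k)%:R * ((n k)%:R * level_pr p c k))))|
          <= D / k%:R ^+ 2].
Proof.
have [C C0 goodC] := level_set_growth c p0 p1.
have lC0 : 0 <= lambda * C by rewrite mulr_ge0 // ltW.
(* Dominates [C + lambda], [2 * (lambda * C)] and [2 * C + lambda], the constants of the separate
   bounds. *)
exists (2 * C + lambda + 2 * (lambda * C)).
  by rewrite !addr_ge0 ?mulr_ge0 // ltW.
near=> k.
have [k0 F0 Fpi pi0 kC] : [/\ (0 < k)%N, (0 < #|F k|)%N,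
    forall w : k.-tuple bool, w \in F k -> word_pr p w = level_pr p c k,
    0 < level_pr p c k & k%:R ^+ 3 / #|F k|%:R <= C / k%:R ^+ 2] by near: k.
set pi := level_pr p c k in Fpi pi0 *.
have Fr0 : 0 < #|F k|%:R :> R by rewrite ltr0n.
have Fpi1 := card_mul_pr_le1 p0' p1' Fpi.
have [b1 b2 b3 b4 b5] := block_parameter_bounds l0 C0 pi0 Fr0 Fpi1 k0 kC.
have [nkL nL BLN] := block_geometry k0.
rewrite -/pi -[Num.truncn _]/(N k) in b1 b2 b3 b4 b5.
have k2 : 0 <= (k%:R ^+ 2)^-1 :> R by rewrite invr_ge0 exprn_ge0.
have npi1 : (n k)%:R * pi <= 1.
  apply: le_trans b3 _; rewrite ler_pdivrMr ?exprn_gt0 ?ltr0n // mul1r.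
  apply: (@le_trans _ _ k%:R); first by near: k; exact: nbhs_infty_ger.
  by rewrite expr2 ler_peMl // ler1n.
have npi0 : 0 <= (n k)%:R * pi by rewrite mulr_ge0 // ltW.
have le_D E : E <= 2 * C + lambda + 2 * (lambda * C) ->
  forall y, y <= E / k%:R ^+ 2 ->
  y <= (2 * C + lambda + 2 * (lambda * C)) / k%:R ^+ 2.
  by move=> ED y /le_trans; apply; rewrite ler_wpM2r.
have D1 : C + lambda <= 2 * C + lambda + 2 * (lambda * C) by lra.
have D2 : 2 * (lambda * C) <= 2 * C + lambda + 2 * (lambda * C).
  by rewrite lerDr addr_ge0 ?mulr_ge0 // ltW.
have D3 : 2 * C + lambda <= 2 * C + lambda + 2 * (lambda * C).
  by rewrite lerDl mulr_ge0.
split.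
- apply: (le_D _ D1).
  apply: le_trans b1; rewrite -(bexp_lost_occ F0 Fpi nkL BLN).
  apply: le_bexp => // s _; rewrite /lost; apply: le_avg => w wF.
  by rewrite ger0_norm // subr_ge0 ler_nat block_occ_le.
- move=> z z0 z1; apply: (le_D _ D2).
  rewrite -mulrA; apply: le_trans (ler_wpM2l _ b2) => //.
  exact: (bexp_pgf_variance p0' p1' (ltW pi0) F0 Fpi nkL z0 z1 BLN).
- exact: (le_D _ D3).
- move=> z z0 z1; apply: (le_D _ D2).
  have t0 : 0 <= 1 - z by rewrite subr_ge0.
  (* Intermediate term: the [B]-th power obtained if clumps inside a block are neglected. It is
     compared with the mean first, then with the exponential. *)
  rewrite -(subrKA ((1 - (1 - z) * ((n k)%:R * pi)) ^+ B k)).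
  apply: le_trans (ler_normD _ _) _.
  have -> : 2 * (lambda * C) / k%:R ^+ 2 =
    lambda * C / k%:R ^+ 2 + lambda * C / k%:R ^+ 2 by ring.
  apply: lerD.
    apply: le_trans b2.
    exact: (avg_block_pgf_le p0' p1' (ltW pi0) F0 Fpi (B k) nkL z0 z1).
  rewrite (mulrCA (1 - z) (B k)%:R); apply: le_trans (expr1B_dist_expR _ _ _) _.
  + by rewrite mulr_ge0.
  + by rewrite mulr_ile1 // gerBl.
  + apply: le_trans b4; rewrite ler_wpM2l // lerXn2r ?nnegrE ?(mulr_ge0 t0 npi0) //.
    by rewrite ler_piMl // gerBl.
Unshelve. all: by end_near. Qed.

Lemma mean_pgf_cvg z : 0 <= z -> z <= 1 ->
  mean_pgf z k @[k --> \oo] --> expR (- ((1 - z) * lambda)).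
Proof.
move=> z0 z1; have [D D0 H] := near_block_bounds.
have Bnpi : (B k)%:R * ((n k)%:R * level_pr p c k) @[k --> \oo] --> lambda.
  by apply: (@cvg_inverse_square _ _ _ D); apply: filterS H => k [].
have e1 : expR (- ((1 - z) * ((B k)%:R * ((n k)%:R * level_pr p c k))))
    @[k --> \oo] --> expR (- ((1 - z) * lambda)).
  apply: continuous_cvg; first exact: continuous_expR.
  by apply: cvgN; apply: cvgMl_tmp.
have e2 : mean_pgf z k -
    expR (- ((1 - z) * ((B k)%:R * ((n k)%:R * level_pr p c k))))
    @[k --> \oo] --> (0 : R).
  apply: (@cvg_inverse_square _ _ _ D); apply: filterS H => k [_ _ _ H].
  by rewrite sub0r normrN; exact: H.
rewrite -[expR _]add0r; under eq_cvg => k do rewrite -(subrK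
  (expR (- ((1 - z) * ((B k)%:R * ((n k)%:R * level_pr p c k))))) (mean_pgf z k)).
exact: cvgD.
Qed.

Lemma ae_lost_cvg0 :
  {ae mu, forall x : bitseq_space, lost k (mkseq x (N k + k)) @[k --> \oo] --> 0}.
Proof.
have [D D0 H] := near_block_bounds.
apply: (@ae_cvg0_inverse_square _ _ _ mu
  (fun k (x : bitseq_space) => lost k (mkseq x (N k + k))) D).
- by move=> k; exact: measurable_mkseq.
- by move=> k x; apply: avg_ge0.
- apply: filterS H => k [H _ _ _]; rewrite (integral_mkseq p0' p1' mup) ?lee_fin //.
  by move=> s; apply: avg_ge0.
Qed.

Lemma ae_fluctuation_cvg0 z : 0 <= z -> z <= 1 ->
  {ae mu, forall x : bitseq_space,
    fluctuation z k (mkseq x (N k + k)) @[k --> \oo] --> 0}.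
Proof.
move=> z0 z1; have [D D0 H] := near_block_bounds.
apply: (@ae_cvg0_inverse_square _ _ _ mu
  (fun k (x : bitseq_space) => fluctuation z k (mkseq x (N k + k))) D).
- by move=> k; exact: measurable_mkseq.
- by move=> k x; exact: sqr_ge0.
- apply: filterS H => k [_ H _ _]; rewrite (integral_mkseq p0' p1' mup) ?lee_fin ?H //.
  by move=> s; exact: sqr_ge0.
Qed.

(** Here [x] is fixed. The chain is [M] to [M'] (powers of [z] are 1-Lipschitz in the exponent),
    then to the mean over all sequences, then to the limit. *)
Lemma quenched_pgf_cvg z x : 0 <= z -> z <= 1 ->
  lost k (mkseq x (N k + k)) @[k --> \oo] --> 0 ->
  fluctuation z k (mkseq x (N k + k)) @[k --> \oo] --> 0 ->
  avg (F k) (fun w => z ^+ occ w (N k) (mkseq x (N k + k))) @[k --> \oo] -->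
    expR (- ((1 - z) * lambda)).
Proof.
move=> z0 z1 lost0 fluct0.
pose G' k := avg (F k)
  (fun w => z ^+ block_occ (B k) (L k) (n k) w (mkseq x (N k + k))).
have G'0 : G' k - mean_pgf z k @[k --> \oo] --> (0 : R).
  apply/cvgr0Pnorm_lt => eps eps0.
  have eps2 : 0 < eps ^+ 2 by rewrite exprn_gt0.
  move/cvgr0Pnorm_lt: fluct0 => /(_ _ eps2); apply: filterS => k.
  by rewrite /fluctuation -/(G' k) normrX ltr_sqr ?nnegrE ?(ltW eps0).
have GG' : avg (F k) (fun w => z ^+ occ w (N k) (mkseq x (N k + k))) - G' k
    @[k --> \oo] --> (0 : R).
  apply/cvgr0Pnorm_lt => eps eps0.
  move/cvgr0Pnorm_lt: lost0 => /(_ _ eps0); apply: filterS => k; apply: le_lt_trans.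
  rewrite [leRHS]ger0_norm; last by apply: avg_ge0.
  rewrite /G' -avgB; apply: le_trans (norm_avg_le _ _) _; apply: le_avg => w _.
  exact: distXn_nat_le.
rewrite -[expR _]add0r; under eq_cvg => k do rewrite -(subrK (G' k) (avg _ _)).
apply: cvgD => //; rewrite -[expR _]add0r.
under eq_cvg => k do rewrite -(subrK (mean_pgf z k) (G' k)).
by apply: cvgD => //; exact: mean_pgf_cvg.
Qed.

End quenched_pgf.

(** * Distribution functions and conclusion *)

Lemma cdf_occurrences_ge0 (R : realType) (p lambda c r : R) (x : nat -> bool) k :
  (0 < #|level_set p c k|)%N -> 0 <= r ->
  cdf (occurrences_rv p lambda c x k) r =
  (\sum_(i < (Num.truncn r).+1) avg (level_set p c k)
    (fun w => (occ w (window_count p lambda c k)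
      (mkseq x (window_count p lambda c k + k)) == i)%:R))%:E.
Proof.
move=> F0 r0; rewrite /cdf /distribution /pushforward /=.
have -> : level_words p c (k := k) = [set w | w \in level_set p c k].
  by apply/seteqP; split => w /=; rewrite inE => /eqP.
rewrite uniform_on_avg //; congr EFin; rewrite -sum_leq_pmf; apply: eq_avg => w _.
congr (nat_of_bool _)%:R; rewrite -natr_le_truncn // -occurrences_occ.
by apply/idP/idP => [/set_mem|H]; [|apply/mem_set]; rewrite /= in_itv.
Qed.

Lemma cdf_lt0 d (T : measurableType d) (R : realType) (P : probability T R)
    (X : {RV P >-> R}) r : (forall w, 0 <= X w) -> r < 0 -> cdf X r = 0%E.
Proof.
move=> X0 r0; rewrite /cdf /distribution /pushforward /=.
rewrite (_ : X @^-1` _ = set0) ?measure0 //; apply/seteqP; split => w //=.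
by rewrite in_itv /= => /(le_trans (X0 w)); rewrite leNgt r0.
Qed.

Theorem theorem1p3 (R : realType) (p lambda c : R)
    (mu : probability bitseq_space R) :
  0 < p -> p < 1 -> 0 < lambda -> is_bernoulli_product p mu ->
  {ae mu, forall x : bitseq_space,
    cvg_in_distribution (fun k => occurrences_rv p lambda c x k)
                        (poisson_rv lambda)}.
Proof.
move=> p0 p1 l0 mup.
pose z j : R := j.+1%:R^-1.
have z0 j : 0 <= z j by rewrite invr_ge0.
have z1 j : z j <= 1 by rewrite invf_le1 // ler1n.
(* The points [z j] are countably many, so one null set serves them all. *)
have fluct0 := ae_foralln (fun j => ae_fluctuation_cvg0 c p0 p1 l0 mup (z0 j) (z1 j)).
apply: filterS2 (ae_lost_cvg0 c p0 p1 l0 mup) fluct0 => x lost0 fluct0 r _.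
have [r0|r0] := ltP r 0.
  rewrite [cdf (poisson_rv _) r]cdf_lt0 //.
  by apply: cvg_near_cst; apply: nearW => k; rewrite cdf_lt0.
pose M k (w : k.-tuple bool) := occ w (window_count p lambda c k)
  (mkseq x (window_count p lambda c k + k)).
have pmf_cvg := pgf_cvg_pmf (fun k => avg_is_pgf (level_set p c k) (@M k))
  (poisson_is_pgf l0)
  (fun j => quenched_pgf_cvg p0 p1 l0 (z0 j) (z1 j) lost0 (fluct0 j)).
rewrite cdf_poisson //.
(* The counts are integers, so the distribution function at [r] is a finite sum of masses, each of
   which converges. *)
have sum_cvg : (\sum_(i < (Num.truncn r).+1) avg (level_set p c k)
      (fun w => (@M k w == i)%:R : R))%:E @[k --> \oo] -->
    (\sum_(i < (Num.truncn r).+1) poisson_pmf lambda i)%:E.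
  apply: cvg_EFin; first exact: nearW.
  by apply: cvg_big => [|i _]; [exact: add_continuous|exact: pmf_cvg].
apply: cvg_trans sum_cvg; apply: near_eq_cvg.
(* Only for large [k] is the level set known to be nonempty; otherwise [uniform_on] takes its
   default value. *)
have [C _ goodC] := level_set_growth c p0 p1.
by apply: filterS goodC => k [_ F0 _ _ _]; rewrite cdf_occurrences_ge0.
Qed.
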